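(* Let $\mathbb A$ be a distributive monoidal category. For any cell $\alpha:(U;A;B;W)$ of the free cornering with iteration $\ulcorner\mathbb A\urcorner^{*}$ and any object $C$ of $\mathbb A$, $$\frac{\alpha\mid\chi_{W,C}}{\sigma_{B,C}}=\frac{\sigma_{A,C}}{\chi_{U,C}\mid\alpha}$$ as cells $(U;A\otimes C;C\otimes B;W)$, where $\chi$ denotes the crossing cells of $\ulcorner\mathbb A\urcorner^{*}$.
   Context: Monoidal categories are strict, and composites are in diagrammatic order ($fg$ is first $f$, then $g$). $\sigma_{A,B}:A\otimes B\to B\otimes A$ is the braiding, also denoting the cell $\ulcorner\sigma_{A,B}\urcorner$. A single-object double category $\mathbb D$ has a horizontal edge monoid $(\mathbb D_H,\otimes,I)$, a vertical edge monoid $(\mathbb D_V,\otimes,I)$, and for $A,B\in\mathbb D_H$, $U,W\in\mathbb D_V$ a set of cells $(U;A;B;W)$ (left; top; bottom; right boundary). For $\alpha:(U;A;B;V)$ and $\beta:(V;A';B';W)$ there is a horizontal composite $\alpha\mid\beta:(U;A\otimes A';B\otimes B';W)$; for $\alpha:(U;A;C;W)$ and $\beta:(U';C;B;W')$ a vertical composite $\frac{\alpha}{\beta}:(U\otimes U';A;B;W\otimes W')$. Both are associative and unital, with horizontal units $id_U:(U;I;I;U)$ and vertical units $1_A:(I;A;A;I)$, where $id_I=1_I$, $1_{A\otimes B}=1_A\mid 1_B$, $id_{U\otimes W}=\frac{id_U}{id_W}$, and interchange $\frac{\alpha}{\beta}\mid\frac{\gamma}{\delta}=\frac{\alpha\mid\gamma}{\beta\mid\delta}$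 holds. A distributive monoidal category $(\mathbb A,\otimes,\oplus,I)$ is a symmetric monoidal category with binary coproducts $A\oplus B$ (injections $\sigma_0,\sigma_1$, copairing $[f,g]$; no initial object required) such that $[\sigma_0\otimes 1_C,\sigma_1\otimes 1_C]:(A\otimes C)\oplus(B\otimes C)\to(A\oplus B)\otimes C$ is invertible for all $A,B,C$. Exchanges with iteration: $\mathbb A^{\circ\bullet}_*$ is the monoid (operation $\otimes$, unit $I$) with elements generated by $A^\circ$, $A^\bullet$ ($A\in\mathbb A_0$), $I$, $U\otimes W$, $U\times W$, $U+W$, $U^\times$, $U^+$, subject to associativity and unitality of $\otimes$ and the equations $U^\times=I\times(U\otimes U^\times)$, $U^+=I+(U\otimes U^+)$. Free cornering with iteration: $\ulcorner\mathbb A\urcorner^{*}$ is the free single-object double category with horizontal edge monoid $(\mathbb A_0,\otimes,I)$, vertical edge monoid $\mathbb A^{\circ\bullet}_*$, and generating cells and equations: (1) for each $f:A\to B$ in $\mathbb A$ a cell $\ulcorner f\urcorner:(I;A;B;I)$ (also written $f$), with $\ulcorner fg\urcorner=\frac{\ulcorner f\urcorner}{\ulcorner g\urcorner}$, $\ulcorner 1_A\urcorner=1_A$, $\ulcorner f\otimes g\urcorner=\ulcorner f\urcorner\mid\ulcorner g\urcorner$; (2) for each $A\in\mathbb A_0$ corner cells $\mathsf{get}_L^A:(A^\circ;I;A;I)$, $\mathsf{put}_R^A:(I;A;I;A^\circ)$, $\mathsf{get}_R^A:(I;I;A;A^\bullet)$, $\mathsf{put}_L^A:(A^\bullet;A;I;I)$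 with $\mathsf{put}_R^A\mid\mathsf{get}_L^A=1_A$, $\frac{\mathsf{get}_L^A}{\mathsf{put}_R^A}=id_{A^\circ}$, $\mathsf{get}_R^A\mid\mathsf{put}_L^A=1_A$, $\frac{\mathsf{get}_R^A}{\mathsf{put}_L^A}=id_{A^\bullet}$; (3) for all $U,W$, cells $\pi_0:(U\times W;I;I;U)$, $\pi_1:(U\times W;I;I;W)$, and for $\alpha:(V;A;B;U)$, $\beta:(V;A;B;W)$ a unique cell $\alpha\times\beta:(V;A;B;U\times W)$ with $(\alpha\times\beta)\mid\pi_0=\alpha$, $(\alpha\times\beta)\mid\pi_1=\beta$; (4) for all $U,W$, cells $\iota_0:(U;I;I;U+W)$, $\iota_1:(W;I;I;U+W)$, and for $\alpha:(U;A;B;V)$, $\beta:(W;A;B;V)$ a unique cell $\alpha+\beta:(U+W;A;B;V)$ with $\iota_0\mid(\alpha+\beta)=\alpha$, $\iota_1\mid(\alpha+\beta)=\beta$; (5) for $\alpha:(U;A;C;W)$, $\beta:(U;B;C;W)$ a unique cell $[\alpha,\beta]:(U;A\oplus B;C;W)$ with $\frac{\ulcorner\sigma_0\urcorner}{[\alpha,\beta]}=\alpha$, $\frac{\ulcorner\sigma_1\urcorner}{[\alpha,\beta]}=\beta$; (6) for $\alpha:(V;A;A;U)$, $f:(W;A;B;K)$, $g:(W;I;I;V\otimes W)$ a unique cell $\alpha^\times_{f,g}:(W;A;B;U^\times\otimes K)$ with $\alpha^\times_{f,g}\mid\frac{\pi_0}{id_K}=f$ and $\alpha^\times_{f,g}\mid\frac{\pi_1}{id_K}=g\mid\frac{\alpha}{\alpha^\times_{f,g}}$;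 (7) for $\alpha:(U;A;A;V)$, $f:(K;A;B;W)$, $g:(V\otimes W;I;I;W)$ a unique cell $\alpha^+_{f,g}:(U^+\otimes K;A;B;W)$ with $\frac{\iota_0}{id_K}\mid\alpha^+_{f,g}=f$ and $\frac{\iota_1}{id_K}\mid\alpha^+_{f,g}=\frac{\alpha}{\alpha^+_{f,g}}\mid g$. Here $\pi_0:U^\times\to I$, $\pi_1:U^\times\to U\otimes U^\times$, $\iota_0:I\to U^+$, $\iota_1:U\otimes U^+\to U^+$ are the projections/injections of $U^\times=I\times(U\otimes U^\times)$ and $U^+=I+(U\otimes U^+)$. For $\alpha:(U;A;A;W)$ put $\alpha^\times=\alpha^\times_{(\pi_0\mid 1_A),\pi_1}:(U^\times;A;A;W^\times)$ and $\alpha^+=\alpha^+_{(1_A\mid\iota_0),\iota_1}:(U^+;A;A;W^+)$. Crossing cells $\chi_{U,B}:(U;B;B;U)$, by induction on $U$: $\chi_{A^\circ,B}$ is the vertical composite (top to bottom) of $\mathsf{get}_L^A\mid 1_B$, $\sigma_{A,B}$, $1_B\mid\mathsf{put}_R^A$; $\chi_{A^\bullet,B}$ is the vertical composite (top to bottom) of $1_B\mid\mathsf{get}_R^A$, $\sigma_{B,A}$, $\mathsf{put}_L^A\mid 1_B$; $\chi_{I,B}=1_B$; $\chi_{U\otimes W,B}=\frac{\chi_{U,B}}{\chi_{W,B}}$; $\chi_{U+W,B}=(\chi_{U,B}\mid\iota_0)+(\chi_{W,B}\mid\iota_1)$; $\chi_{U\times W,B}=(\pi_0\mid\chi_{U,B})\times(\pi_1\mid\chi_{W,B})$;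 $\chi_{U^\times,B}=(\chi_{U,B})^\times$; $\chi_{U^+,B}=(\chi_{U,B})^+$. *)

(* Defs.v *)
From Corelib Require Import ssreflect.

Set Implicit Arguments.
Unset Strict Implicit.
Unset Printing Implicit Defensive.

Declare Scope obj_scope.
Declare Scope vexp_scope.
Declare Scope cell_scope.
Delimit Scope obj_scope with obj.
Delimit Scope vexp_scope with vexp.
Delimit Scope cell_scope with cell.

(** Composition is in diagrammatic order: [comp f g] is first [f], then [g]. *)

Record category := Category {
  obj :> Type;
  hom : obj -> obj -> Type;
  idm : forall A, hom A A;
  comp : forall A B C, hom A B -> hom B C -> hom A C;
  comp1m : forall A B (f : hom A B), comp (idm A) f = f;
  compm1 : forall A B (f : hom A B), comp f (idm B) = f;
  compA : forall A B C D (f : hom A B) (g : hom B C) (h : hom C D),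
    comp f (comp g h) = comp (comp f g) h }.

Bind Scope obj_scope with obj.
Arguments hom {c} (_ _)%_obj_scope.
Arguments idm {c} A%_obj_scope.
Arguments comp {c A B C} f g.

(** Strictness means that the associativity and unit constraints are equalities
    of objects; [hcast] moves a morphism along such equalities. *)
Definition hcast (X : category) (A A' B B' : X) (eA : A = A') (eB : B = B') :
    hom A B -> hom A' B' :=
  match eA in _ = A1, eB in _ = B1 return hom A B -> hom A1 B1 with
  | eq_refl, eq_refl => fun f => f
  end.

Record ssmcat := SSMCat {
  ssmcat_cat :> category;
  tens : ssmcat_cat -> ssmcat_cat -> ssmcat_cat;
  unit : ssmcat_cat;
  tensA : forall A B C, tens A (tens B C) = tens (tens A B) C;
  tens1o : forall A, tens unit A = A;
  tenso1 : forall A, tens A unit = A;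
  tensm : forall A A' B B', hom A B -> hom A' B' -> hom (tens A A') (tens B B');
  tensm_id : forall A B, tensm (idm A) (idm B) = idm (tens A B);
  tensm_comp : forall A B C A' B' C'
      (f : hom A B) (g : hom B C) (f' : hom A' B') (g' : hom B' C'),
    tensm (comp f g) (comp f' g') = comp (tensm f f') (tensm g g');
  tensmA : forall A B A' B' A'' B''
      (f : hom A B) (g : hom A' B') (h : hom A'' B''),
    hcast (tensA A A' A'') (tensA B B' B'') (tensm f (tensm g h))
      = tensm (tensm f g) h;
  tensm1m : forall A B (f : hom A B),
    hcast (tens1o A) (tens1o B) (tensm (idm unit) f) = f;
  tensmm1 : forall A B (f : hom A B),
    hcast (tenso1 A) (tenso1 B) (tensm f (idm unit)) = f;
  braid : forall A B, hom (tens A B) (tens B A);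
  braid_nat : forall A A' B B' (f : hom A B) (g : hom A' B'),
    comp (tensm f g) (braid B B') = comp (braid A A') (tensm g f);
  braid_sym : forall A B, comp (braid A B) (braid B A) = idm (tens A B);
  braid_hexagon : forall A B C,
    braid (tens A B) C =
      comp (hcast (tensA A B C) (tensA A C B) (tensm (idm A) (braid B C)))
           (hcast eq_refl (eq_sym (tensA C A B)) (tensm (braid A C) (idm B))) }.

Arguments tens {s} (_ _)%_obj_scope.
Arguments unit {s}.
Arguments tensA {s} (A B C)%_obj_scope.
Arguments tens1o {s} A%_obj_scope.
Arguments tenso1 {s} A%_obj_scope.
Arguments tensm {s A A' B B'} f g.
Arguments braid {s} (A B)%_obj_scope.

Notation "A ⊗ B" := (tens A B) (at level 40, left associativity) : obj_scope.

Definition is_iso (X : category) (A B : X) (f : hom A B) : Prop :=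
  exists g : hom B A, comp f g = idm A /\ comp g f = idm B.

Record dmcat := DMCat {
  dmcat_ssmcat :> ssmcat;
  oplus : dmcat_ssmcat -> dmcat_ssmcat -> dmcat_ssmcat;
  inj0 : forall A B, hom A (oplus A B);
  inj1 : forall A B, hom B (oplus A B);
  copair : forall A B C, hom A C -> hom B C -> hom (oplus A B) C;
  copair0 : forall A B C (f : hom A C) (g : hom B C),
    comp (inj0 A B) (copair f g) = f;
  copair1 : forall A B C (f : hom A C) (g : hom B C),
    comp (inj1 A B) (copair f g) = g;
  copair_uniq : forall A B C (f : hom A C) (g : hom B C) (h : hom (oplus A B) C),
    comp (inj0 A B) h = f -> comp (inj1 A B) h = g -> h = copair f g;
  distributive : forall A B C,
    is_iso (copair (tensm (inj0 A B) (idm C)) (tensm (inj1 A B) (idm C))) }.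

Arguments oplus {d} (_ _)%_obj_scope.
Arguments inj0 {d} (A B)%_obj_scope.
Arguments inj1 {d} (A B)%_obj_scope.
Arguments copair {d A B C} f g.

Notation "A ⊕ B" := (oplus A B) (at level 50, left associativity) : obj_scope.

(** The vertical edge monoid is presented as the type [vexp] of expressions
    modulo the congruence [veq]. *)

Inductive vexp (X : Type) : Type :=
| vcirc (A : X)
| vbullet (A : X)
| vone
| vtens (U W : vexp X)
| vprod (U W : vexp X)
| vsum (U W : vexp X)
| vitX (U : vexp X)
| vitP (U : vexp X).

Arguments vcirc {X} A.
Arguments vbullet {X} A.
Arguments vone {X}.
Bind Scope vexp_scope with vexp.

Notation "A ^∘" := (vcirc A) (at level 1, format "A ^∘") : vexp_scope.
Notation "A ^•" := (vbullet A) (at level 1, format "A ^•") : vexp_scope.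
Notation "U ⊗ W" := (vtens U W) (at level 40, left associativity) : vexp_scope.
Notation "U × W" := (vprod U W) (at level 40, left associativity) : vexp_scope.
Notation "U + W" := (vsum U W) : vexp_scope.
Notation "U ^×" := (vitX U) (at level 1, format "U ^×") : vexp_scope.
Notation "U ^+" := (vitP U) (at level 1, format "U ^+") : vexp_scope.

Local Open Scope vexp_scope.

Inductive veq (X : Type) : vexp X -> vexp X -> Prop :=
| veq_refl U : veq U U
| veq_sym U W : veq U W -> veq W U
| veq_trans U V W : veq U V -> veq V W -> veq U W
| veq_tens U U' W W' : veq U U' -> veq W W' -> veq (U ⊗ W) (U' ⊗ W')
| veq_prod U U' W W' : veq U U' -> veq W W' -> veq (U × W) (U' × W')
| veq_sum U U' W W' : veq U U' -> veq W W' -> veq (U + W) (U' + W')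
| veq_itX U U' : veq U U' -> veq U^× U'^×
| veq_itP U U' : veq U U' -> veq U^+ U'^+
| veq_tensA U V W : veq (U ⊗ (V ⊗ W)) ((U ⊗ V) ⊗ W)
| veq_tens1v U : veq (vone ⊗ U) U
| veq_tensv1 U : veq (U ⊗ vone) U
| veq_unfoldX U : veq U^× (vone × (U ⊗ U^×))
| veq_unfoldP U : veq U^+ (vone + (U ⊗ U^+)).

Arguments veq_refl {X U}.
Arguments veq_tens1v {X U}.
Arguments veq_tensv1 {X U}.
Arguments veq_unfoldX {X U}.
Arguments veq_unfoldP {X U}.

(** The cells of the free cornering are the terms [cell U A B W] (left, top,
    bottom, right boundary) modulo [ceq].  Boundaries only need to agree modulo
    [veq] on vertical edges and modulo equality on objects: [ccast] replaces the
    boundary of a cell by an equal one, and [ceq], which relates cells whose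
    boundaries are equal but possibly written differently, identifies a cell
    with all its casts.  The terms [iterX a f g] and [iterP a f g] stand for
    [a^×_{f,g}] and [a^+_{f,g}].  Each existence-and-uniqueness clause of the
    presentation is a term former together with its equations and a conditional
    rule [ceq_*_uniq]. *)

Inductive cell (X : dmcat) : vexp X -> X -> X -> vexp X -> Type :=
| ccast U U' (A A' B B' : X) W W' :
    veq U U' -> A = A' -> B = B' -> veq W W' -> cell U A B W -> cell U' A' B' W'
| cid U : cell U unit unit U
| cone (A : X) : cell vone A A vone
| hcomp U (A B : X) V (A' B' : X) W :
    cell U A B V -> cell V A' B' W -> cell U (A ⊗ A') (B ⊗ B') W
| vcomp U (A C : X) W U' (B : X) W' :
    cell U A C W -> cell U' C B W' -> cell (U ⊗ U') A B (W ⊗ W')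
| emb (A B : X) : hom A B -> cell vone A B vone
| getL (A : X) : cell A^∘ unit A vone
| putR (A : X) : cell vone A unit A^∘
| getR (A : X) : cell vone unit A A^•
| putL (A : X) : cell A^• A unit vone
| cproj0 U W : cell (U × W) unit unit U
| cproj1 U W : cell (U × W) unit unit W
| cpair V (A B : X) U W : cell V A B U -> cell V A B W -> cell V A B (U × W)
| cinj0 U W : cell U unit unit (U + W)
| cinj1 U W : cell W unit unit (U + W)
| ccase U W (A B : X) V : cell U A B V -> cell W A B V -> cell (U + W) A B V
| ccopair U (A B C : X) W :
    cell U A C W -> cell U B C W -> cell U (A ⊕ B)%obj C W
| iterX V (A : X) U W (B : X) K :
    cell V A A U -> cell W A B K -> cell W unit unit (V ⊗ W) ->
    cell W A B (U^× ⊗ K)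
| iterP U (A : X) V K (B : X) W :
    cell U A A V -> cell K A B W -> cell (V ⊗ W) unit unit W ->
    cell (U^+ ⊗ K) A B W.

Bind Scope cell_scope with cell.
Arguments ccast {X U U' A A' B B' W W'} _ _ _ _ a.
Arguments cid {X} U.
Arguments cone {X} A%_obj_scope.
Arguments hcomp {X U A B V A' B' W} a b.
Arguments vcomp {X U A C W U' B W'} a b.
Arguments emb {X A B} f.
Arguments getL {X} A%_obj_scope.
Arguments putR {X} A%_obj_scope.
Arguments getR {X} A%_obj_scope.
Arguments putL {X} A%_obj_scope.
Arguments cproj0 {X} U W.
Arguments cproj1 {X} U W.
Arguments cpair {X V A B U W} a b.
Arguments cinj0 {X} U W.
Arguments cinj1 {X} U W.
Arguments ccase {X U W A B V} a b.
Arguments ccopair {X U A B C W} a b.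
Arguments iterX {X V A U W B K} a f g.
Arguments iterP {X U A V K B W} a f g.

(** Projections and injections of [U^× = I × (U ⊗ U^×)] and
    [U^+ = I + (U ⊗ U^+)]. *)
Definition projX0 (X : dmcat) (U : vexp X) : cell U^× unit unit vone :=
  ccast (veq_sym veq_unfoldX) eq_refl eq_refl veq_refl (cproj0 vone (U ⊗ U^×)).

Definition projX1 (X : dmcat) (U : vexp X) : cell U^× unit unit (U ⊗ U^×) :=
  ccast (veq_sym veq_unfoldX) eq_refl eq_refl veq_refl (cproj1 vone (U ⊗ U^×)).

Definition injP0 (X : dmcat) (U : vexp X) : cell vone unit unit U^+ :=
  ccast veq_refl eq_refl eq_refl (veq_sym veq_unfoldP) (cinj0 vone (U ⊗ U^+)).

Definition injP1 (X : dmcat) (U : vexp X) : cell (U ⊗ U^+) unit unit U^+ :=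
  ccast veq_refl eq_refl eq_refl (veq_sym veq_unfoldP) (cinj1 vone (U ⊗ U^+)).

Local Open Scope cell_scope.

Reserved Notation "a ≈ b" (at level 70, no associativity).

Inductive ceq (X : dmcat) :
  forall (U : vexp X) (A B : X) (W : vexp X), cell U A B W ->
  forall (U' : vexp X) (A' B' : X) (W' : vexp X), cell U' A' B' W' -> Prop :=
| ceq_refl U A B W (a : cell U A B W) : a ≈ a
| ceq_sym U A B W (a : cell U A B W) U' A' B' W' (a' : cell U' A' B' W') :
    a ≈ a' -> a' ≈ a
| ceq_trans U A B W (a : cell U A B W) U' A' B' W' (a' : cell U' A' B' W')
    U'' A'' B'' W'' (a'' : cell U'' A'' B'' W'') :
    a ≈ a' -> a' ≈ a'' -> a ≈ a''
| ceq_cast U U' A A' B B' W W' (eU : veq U U') (eA : A = A') (eB : B = B')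
    (eW : veq W W') (a : cell U A B W) :
    ccast eU eA eB eW a ≈ a
| ceq_cid U U' : veq U U' -> cid U ≈ cid U'
| ceq_hcomp U A B V A' B' W (a : cell U A B V) (b : cell V A' B' W)
    U1 A1 B1 V1 A1' B1' W1 (a1 : cell U1 A1 B1 V1) (b1 : cell V1 A1' B1' W1) :
    a ≈ a1 -> b ≈ b1 -> hcomp a b ≈ hcomp a1 b1
| ceq_vcomp U A C W U' B W' (a : cell U A C W) (b : cell U' C B W')
    U1 A1 C1 W1 U1' B1 W1' (a1 : cell U1 A1 C1 W1) (b1 : cell U1' C1 B1 W1') :
    a ≈ a1 -> b ≈ b1 -> vcomp a b ≈ vcomp a1 b1
| ceq_cproj0 U U' W W' : veq U U' -> veq W W' -> cproj0 U W ≈ cproj0 U' W'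
| ceq_cproj1 U U' W W' : veq U U' -> veq W W' -> cproj1 U W ≈ cproj1 U' W'
| ceq_cpair V A B U W (a : cell V A B U) (b : cell V A B W)
    V1 A1 B1 U1 W1 (a1 : cell V1 A1 B1 U1) (b1 : cell V1 A1 B1 W1) :
    a ≈ a1 -> b ≈ b1 -> cpair a b ≈ cpair a1 b1
| ceq_cinj0 U U' W W' : veq U U' -> veq W W' -> cinj0 U W ≈ cinj0 U' W'
| ceq_cinj1 U U' W W' : veq U U' -> veq W W' -> cinj1 U W ≈ cinj1 U' W'
| ceq_ccase U W A B V (a : cell U A B V) (b : cell W A B V)
    U1 W1 A1 B1 V1 (a1 : cell U1 A1 B1 V1) (b1 : cell W1 A1 B1 V1) :
    a ≈ a1 -> b ≈ b1 -> ccase a b ≈ ccase a1 b1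
| ceq_ccopair U A B C W (a : cell U A C W) (b : cell U B C W)
    U1 A1 B1 C1 W1 (a1 : cell U1 A1 C1 W1) (b1 : cell U1 B1 C1 W1) :
    a ≈ a1 -> b ≈ b1 -> ccopair a b ≈ ccopair a1 b1
| ceq_iterX V A U W B K
    (a : cell V A A U) (f : cell W A B K) (g : cell W unit unit (V ⊗ W))
    V1 A1 U1 W1 B1 K1
    (a1 : cell V1 A1 A1 U1) (f1 : cell W1 A1 B1 K1)
    (g1 : cell W1 unit unit (V1 ⊗ W1)) :
    a ≈ a1 -> f ≈ f1 -> g ≈ g1 -> iterX a f g ≈ iterX a1 f1 g1
| ceq_iterP U A V K B W
    (a : cell U A A V) (f : cell K A B W) (g : cell (V ⊗ W) unit unit W)
    U1 A1 V1 K1 B1 W1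
    (a1 : cell U1 A1 A1 V1) (f1 : cell K1 A1 B1 W1)
    (g1 : cell (V1 ⊗ W1) unit unit W1) :
    a ≈ a1 -> f ≈ f1 -> g ≈ g1 -> iterP a f g ≈ iterP a1 f1 g1
| ceq_hcompA U A B V A' B' V' A'' B'' W
    (a : cell U A B V) (b : cell V A' B' V') (c : cell V' A'' B'' W) :
    hcomp a (hcomp b c) ≈ hcomp (hcomp a b) c
| ceq_hcomp1c U A B W (a : cell U A B W) : hcomp (cid U) a ≈ a
| ceq_hcompc1 U A B W (a : cell U A B W) : hcomp a (cid W) ≈ a
| ceq_vcompA U A B W U' C W' U'' D W''
    (a : cell U A B W) (b : cell U' B C W') (c : cell U'' C D W'') :
    vcomp a (vcomp b c) ≈ vcomp (vcomp a b) c
| ceq_vcomp1c U A B W (a : cell U A B W) : vcomp (cone A) a ≈ a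
| ceq_vcompc1 U A B W (a : cell U A B W) : vcomp a (cone B) ≈ a
| ceq_cid_one : cid vone ≈ cone unit
| ceq_cone_tens A B : cone (A ⊗ B) ≈ hcomp (cone A) (cone B)
| ceq_cid_tens U W : cid (U ⊗ W) ≈ vcomp (cid U) (cid W)
| ceq_interchange U A C W U' B W' A' C' V B' V'
    (a : cell U A C W) (b : cell U' C B W')
    (c : cell W A' C' V) (d : cell W' C' B' V') :
    hcomp (vcomp a b) (vcomp c d) ≈ vcomp (hcomp a c) (hcomp b d)
| ceq_emb_comp A B C (f : hom A B) (g : hom B C) :
    emb (comp f g) ≈ vcomp (emb f) (emb g)
| ceq_emb_id A : emb (idm A) ≈ cone A
| ceq_emb_tens A B A' B' (f : hom A B) (g : hom A' B') :
    emb (tensm f g) ≈ hcomp (emb f) (emb g)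
| ceq_putR_getL A : hcomp (putR A) (getL A) ≈ cone A
| ceq_getL_putR A : vcomp (getL A) (putR A) ≈ cid A^∘
| ceq_getR_putL A : hcomp (getR A) (putL A) ≈ cone A
| ceq_getR_putL_v A : vcomp (getR A) (putL A) ≈ cid A^•
| ceq_cpair0 V A B U W (a : cell V A B U) (b : cell V A B W) :
    hcomp (cpair a b) (cproj0 U W) ≈ a
| ceq_cpair1 V A B U W (a : cell V A B U) (b : cell V A B W) :
    hcomp (cpair a b) (cproj1 U W) ≈ b
| ceq_cpair_uniq V A B U W (a : cell V A B U) (b : cell V A B W)
    (h : cell V A B (U × W)) :
    hcomp h (cproj0 U W) ≈ a -> hcomp h (cproj1 U W) ≈ b -> h ≈ cpair a b
| ceq_ccase0 U W A B V (a : cell U A B V) (b : cell W A B V) :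
    hcomp (cinj0 U W) (ccase a b) ≈ a
| ceq_ccase1 U W A B V (a : cell U A B V) (b : cell W A B V) :
    hcomp (cinj1 U W) (ccase a b) ≈ b
| ceq_ccase_uniq U W A B V (a : cell U A B V) (b : cell W A B V)
    (h : cell (U + W) A B V) :
    hcomp (cinj0 U W) h ≈ a -> hcomp (cinj1 U W) h ≈ b -> h ≈ ccase a b
| ceq_ccopair0 U A B C W (a : cell U A C W) (b : cell U B C W) :
    vcomp (emb (inj0 A B)) (ccopair a b) ≈ a
| ceq_ccopair1 U A B C W (a : cell U A C W) (b : cell U B C W) :
    vcomp (emb (inj1 A B)) (ccopair a b) ≈ b
| ceq_ccopair_uniq U A B C W (a : cell U A C W) (b : cell U B C W)
    (h : cell U (A ⊕ B)%obj C W) :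
    vcomp (emb (inj0 A B)) h ≈ a -> vcomp (emb (inj1 A B)) h ≈ b ->
    h ≈ ccopair a b
| ceq_iterX0 V A U W B K
    (a : cell V A A U) (f : cell W A B K) (g : cell W unit unit (V ⊗ W)) :
    hcomp (iterX a f g) (vcomp (projX0 U) (cid K)) ≈ f
| ceq_iterX1 V A U W B K
    (a : cell V A A U) (f : cell W A B K) (g : cell W unit unit (V ⊗ W)) :
    hcomp (iterX a f g) (vcomp (projX1 U) (cid K))
      ≈ hcomp g (vcomp a (iterX a f g))
| ceq_iterX_uniq V A U W B K
    (a : cell V A A U) (f : cell W A B K) (g : cell W unit unit (V ⊗ W))
    (h : cell W A B (U^× ⊗ K)) :
    hcomp h (vcomp (projX0 U) (cid K)) ≈ f ->
    hcomp h (vcomp (projX1 U) (cid K)) ≈ hcomp g (vcomp a h) ->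
    h ≈ iterX a f g
| ceq_iterP0 U A V K B W
    (a : cell U A A V) (f : cell K A B W) (g : cell (V ⊗ W) unit unit W) :
    hcomp (vcomp (injP0 U) (cid K)) (iterP a f g) ≈ f
| ceq_iterP1 U A V K B W
    (a : cell U A A V) (f : cell K A B W) (g : cell (V ⊗ W) unit unit W) :
    hcomp (vcomp (injP1 U) (cid K)) (iterP a f g)
      ≈ hcomp (vcomp a (iterP a f g)) g
| ceq_iterP_uniq U A V K B W
    (a : cell U A A V) (f : cell K A B W) (g : cell (V ⊗ W) unit unit W)
    (h : cell (U^+ ⊗ K) A B W) :
    hcomp (vcomp (injP0 U) (cid K)) h ≈ f ->
    hcomp (vcomp (injP1 U) (cid K)) h ≈ hcomp (vcomp a h) g ->
    h ≈ iterP a f g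
where "a ≈ b" := (ceq a b) : cell_scope.

Lemma ceq_boundary (X : dmcat) U A B W (a : cell (X := X) U A B W)
    U' A' B' W' (a' : cell U' A' B' W') :
  a ≈ a' -> veq U U' /\ A = A' /\ B = B' /\ veq W W'.
Proof.
  induction 1;
    repeat match goal with H : _ /\ _ |- _ => destruct H end; subst;
    repeat split;
    rewrite ?tensA ?tens1o ?tenso1; eauto using veq, eq_trans.
Qed.

Definition iterXs (X : dmcat) (U : vexp X) (A : X) (W : vexp X)
    (a : cell U A A W) : cell U^× A A W^× :=
  ccast veq_refl eq_refl eq_refl veq_tensv1
    (iterX a
      (ccast veq_refl (tens1o A) (tens1o A) veq_refl (hcomp (projX0 U) (cone A)))
      (projX1 U)).

Definition iterPs (X : dmcat) (U : vexp X) (A : X) (W : vexp X)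
    (a : cell U A A W) : cell U^+ A A W^+ :=
  ccast veq_tensv1 eq_refl eq_refl veq_refl
    (iterP a
      (ccast veq_refl (tenso1 A) (tenso1 A) veq_refl (hcomp (cone A) (injP0 W)))
      (injP1 W)).

(** Recursion is on expressions: that [veq]-equal expressions have [ceq]-equal
    crossing cells is a property of [chi], not part of its definition. *)
Fixpoint chi (X : dmcat) (U : vexp X) (B : X) {struct U} : cell U B B U :=
  match U return cell U B B U with
  | A^∘ =>
      ccast (veq_trans veq_tensv1 veq_tensv1) (tens1o B) (tenso1 B)
        (veq_trans (veq_tens veq_tens1v veq_refl) veq_tens1v)
        (vcomp (vcomp (hcomp (getL A) (cone B)) (emb (braid A B)))
          (hcomp (cone B) (putR A)))
  | A^• =>
      ccast (veq_trans (veq_tens veq_tens1v veq_refl) veq_tens1v)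
        (tenso1 B) (tens1o B) (veq_trans veq_tensv1 veq_tensv1)
        (vcomp (vcomp (hcomp (cone B) (getR A)) (emb (braid B A)))
          (hcomp (putL A) (cone B)))
  | vone => cone B
  | V ⊗ W => vcomp (chi V B) (chi W B)
  | V × W =>
      ccast veq_refl (tens1o B) (tens1o B) veq_refl
        (cpair (hcomp (cproj0 V W) (chi V B)) (hcomp (cproj1 V W) (chi W B)))
  | V + W =>
      ccast veq_refl (tenso1 B) (tenso1 B) veq_refl
        (ccase (hcomp (chi V B) (cinj0 V W)) (hcomp (chi W B) (cinj1 V W)))
  | V^× => iterXs (chi V B)
  | V^+ => iterPs (chi V B)
  end.

Arguments chi {X} U B.

(* Main.v *)
(** Induction on [alpha].  Tensor composites use the hexagon, corner cells use
    the corner equations, and casts use the fact that [chi] respects [veq]: the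
    unfoldings of [U^×] and [U^+] are the equations characterising the iterated
    crossing cells.  For a (co)pairing, both sides of the equation have the same
    composites with the projections (injections); for a copairing over [A ⊕ B]
    this needs distributivity, since the top boundary is [(A ⊕ B) ⊗ C].  For
    [a^×_{f,g}] and [a^+_{f,g}] both sides satisfy the universal property of the
    iteration of [a ∣ χ], with [f] replaced by its slid version and the same [g],
    which commutes with crossing cells by induction. *)

From Corelib Require Import ssreflect.
From Stdlib Require Import Setoid Morphisms.
Require Import Defs.

Set Implicit Arguments.
Unset Strict Implicit.
Unset Printing Implicit Defensive.

Local Open Scope cell_scope.

(** * Pasting diagrams *)

#[local] Instance veq_equiv (X : Type) : Equivalence (@veq X).
Proof. split; [exact: @veq_refl | exact: @veq_sym | exact: @veq_trans]. Qed.

#[local] Instance vtens_proper (X : Type) :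
  Proper (@veq X ==> @veq X ==> @veq X) (@vtens X).
Proof. by move=> U U' eU W W' eW; apply: veq_tens. Qed.

#[local] Hint Resolve veq_refl ceq_refl : core.

(** A pasting diagram with a proposition saying that its boundaries match, so
    that composition of diagrams is total and, unlike composition of cells,
    needs no casts; strict equalities of boundaries become side conditions of
    the laws instead.  This makes [deq] amenable to setoid rewriting. *)
Record diagram (X : dmcat) := Diagram {
  dleft : vexp X;
  dtop : X;
  dbot : X;
  dright : vexp X;
  composable : Prop;
  diag_cell : composable -> cell dleft dtop dbot dright;
  diag_cell_irr : forall p q, diag_cell p ≈ diag_cell q }.

(** The last clause is vacuous for diagrams that are not composable. The boundary clauses and the
    equivalence of composability are therefore stated separately; they are what makes both
    compositions respect [≡]. *)
Definition deq (X : dmcat) (a b : diagram X) : Prop :=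
  (veq (dleft a) (dleft b) /\ dtop a = dtop b /\
   dbot a = dbot b /\ veq (dright a) (dright b)) /\
  (composable a <-> composable b) /\
  forall p q, diag_cell (d := a) p ≈ diag_cell (d := b) q.

Declare Scope diagram_scope.
Delimit Scope diagram_scope with diag.
Bind Scope diagram_scope with diagram.
Local Open Scope diagram_scope.
Notation "a ≡ b" := (deq a b) (at level 70, no associativity) : diagram_scope.

#[local] Instance deq_equiv (X : dmcat) : Equivalence (@deq X).
Proof.
split.
- move=> a; split; first by repeat split; exact: veq_refl.
  by split=> //; exact: diag_cell_irr.
- move=> a b [[eL [eT [eB eR]]] [eC e]]; split; first by repeat split=> //; exact: veq_sym.
  by split; [tauto | move=> p q; apply: ceq_sym].
- move=> a b c [[L1 [T1 [B1 R1]]] [C1 e1]] [[L2 [T2 [B2 R2]]] [C2 e2]].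
  split.
    split; first exact: veq_trans L1 L2.
    by split; [congruence | split; [congruence | exact: veq_trans R1 R2]].
  split; first by tauto.
  move=> p q; have r : composable b by tauto.
  exact: ceq_trans (e1 p r) (e2 r q).
Qed.

#[local] Hint Extern 0 (deq _ _) => reflexivity : core.

Definition cell_diag (X : dmcat) (U : vexp X) (A B : X) (W : vexp X)
    (a : cell U A B W) : diagram X :=
  Diagram (composable := True) (diag_cell := fun _ => a) (fun _ _ => ceq_refl a).

Notation "⟦ a ⟧" := (cell_diag a) (format "⟦ a ⟧") : diagram_scope.

(** The bridge in both directions: equations are proved by rewriting diagrams, then read back as
    equations of cells. The boundary clauses of [≡] come from [ceq_boundary]. *)
Lemma cell_diag_eq (X : dmcat) (U : vexp X) (A B : X) (W : vexp X) (a : cell U A B W)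
    (U' : vexp X) (A' B' : X) (W' : vexp X) (a' : cell U' A' B' W') :
  ⟦a⟧ ≡ ⟦a'⟧ <-> a ≈ a'.
Proof.
split; first by case=> _ [_ /(_ I I)].
by move=> e; split; [exact: ceq_boundary e|].
Qed.

Definition hor_cell (X : dmcat) (a b : diagram X)
    (p : composable a /\ composable b /\ veq (dright a) (dleft b)) :
    cell (dleft a) (dtop a ⊗ dtop b)%obj (dbot a ⊗ dbot b)%obj (dright b) :=
  match p with
  | conj pa (conj pb e) =>
      hcomp (ccast veq_refl eq_refl eq_refl e (diag_cell pa)) (diag_cell pb)
  end.

Definition ver_cell (X : dmcat) (a b : diagram X)
    (p : composable a /\ composable b /\ dbot a = dtop b) :
    cell (dleft a ⊗ dleft b) (dtop a) (dbot b) (dright a ⊗ dright b) :=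
  match p with
  | conj pa (conj pb e) =>
      vcomp (ccast veq_refl eq_refl e veq_refl (diag_cell pa)) (diag_cell pb)
  end.

(** Allowing different proofs [p] and [p'] serves two ends: for equal diagrams it is the irrelevance
    field of [hor], and in general it is the cell clause of congruence. *)
Lemma hor_cell_congr (X : dmcat) (a b a' b' : diagram X) p p' :
  a ≡ a' -> b ≡ b' -> hor_cell (a := a) (b := b) p ≈ hor_cell (a := a') (b := b') p'.
Proof.
case: p p' => pa [pb e] [pa' [pb' e']] [_ [_ ea]] [_ [_ eb]] /=.
apply: ceq_hcomp => //.
exact: ceq_trans (ceq_cast _ _ _ _ _) (ceq_trans (ea pa pa') (ceq_sym (ceq_cast _ _ _ _ _))).
Qed.

Lemma ver_cell_congr (X : dmcat) (a b a' b' : diagram X) p p' :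
  a ≡ a' -> b ≡ b' -> ver_cell (a := a) (b := b) p ≈ ver_cell (a := a') (b := b') p'.
Proof.
case: p p' => pa [pb e] [pa' [pb' e']] [_ [_ ea]] [_ [_ eb]] /=.
apply: ceq_vcomp => //.
exact: ceq_trans (ceq_cast _ _ _ _ _) (ceq_trans (ea pa pa') (ceq_sym (ceq_cast _ _ _ _ _))).
Qed.

Definition hor (X : dmcat) (a b : diagram X) : diagram X :=
  Diagram (fun p q => hor_cell_congr p q (reflexivity a) (reflexivity b)).

Definition ver (X : dmcat) (a b : diagram X) : diagram X :=
  Diagram (fun p q => ver_cell_congr p q (reflexivity a) (reflexivity b)).

Notation "a ∣ b" := (hor a b) (at level 45, left associativity) : diagram_scope.
Notation "a ⁄ b" := (ver a b) (at level 47, left associativity) : diagram_scope.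

Lemma hor_congr (X : dmcat) (a a' b b' : diagram X) :
  a ≡ a' -> b ≡ b' -> a ∣ b ≡ a' ∣ b'.
Proof.
move=> ea eb; split; last split.
- move: ea eb => [[L1 [T1 [B1 R1]]] _] [[L2 [T2 [B2 R2]]] _] /=.
  by repeat split=> //; congruence.
- move: ea eb => [[_ [_ [_ R1]]] [C1 _]] [[L2 _] [C2 _]] /=.
  by rewrite R1 L2 C1 C2.
- by move=> p q; exact: (hor_cell_congr p q ea eb).
Qed.

#[local] Instance hor_proper (X : dmcat) :
  Proper (@deq X ==> @deq X ==> @deq X) (@hor X).
Proof. by move=> a a' ea b b' eb; exact: hor_congr. Qed.

Lemma ver_congr (X : dmcat) (a a' b b' : diagram X) :
  a ≡ a' -> b ≡ b' -> a ⁄ b ≡ a' ⁄ b'.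
Proof.
move=> ea eb; split; last split.
- move: ea eb => [[L1 [T1 [B1 R1]]] _] [[L2 [T2 [B2 R2]]] _] /=.
  by split; [|split; [|split]] => //; apply: veq_tens.
- move: ea eb => [[_ [_ [B1 _]]] [C1 _]] [[_ [T2 _]] [C2 _]] /=.
  by rewrite B1 T2 C1 C2.
- by move=> p q; exact: (ver_cell_congr p q ea eb).
Qed.

#[local] Instance ver_proper (X : dmcat) :
  Proper (@deq X ==> @deq X ==> @deq X) (@ver X).
Proof. by move=> a a' ea b b' eb; exact: ver_congr. Qed.

Lemma cell_diag_cast (X : dmcat) (U U' : vexp X) (A A' B B' : X) (W W' : vexp X)
    (eU : veq U U') (eA : A = A') (eB : B = B') (eW : veq W W') (a : cell U A B W) :
  ⟦ccast eU eA eB eW a⟧ ≡ ⟦a⟧.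
Proof. by apply/cell_diag_eq; exact: ceq_cast. Qed.

Lemma cell_diag_hcomp (X : dmcat) (U : vexp X) (A B : X) (V : vexp X) (A' B' : X)
    (W : vexp X) (a : cell U A B V) (b : cell V A' B' W) :
  ⟦hcomp a b⟧ ≡ ⟦a⟧ ∣ ⟦b⟧.
Proof.
split; first by repeat split; exact: veq_refl.
split; first by split=> // _; repeat split; exact: veq_refl.
move=> ? [? [? e]] /=; apply: ceq_hcomp; last exact: ceq_refl.
by apply: ceq_sym; exact: ceq_cast.
Qed.

Lemma cell_diag_vcomp (X : dmcat) (U : vexp X) (A C : X) (W U' : vexp X) (B : X)
    (W' : vexp X) (a : cell U A C W) (b : cell U' C B W') :
  ⟦vcomp a b⟧ ≡ ⟦a⟧ ⁄ ⟦b⟧.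
Proof.
split; first by repeat split; exact: veq_refl.
split; first by split=> // _; repeat split.
move=> ? [? [? e]] /=; apply: ceq_vcomp; last exact: ceq_refl.
by apply: ceq_sym; exact: ceq_cast.
Qed.

(** The cell clause quantifies over proofs of composability, so such a proof may be assumed when
    checking a law. *)
Lemma deq_of_composable (X : dmcat) (a b : diagram X) :
  veq (dleft a) (dleft b) -> dtop a = dtop b -> dbot a = dbot b ->
  veq (dright a) (dright b) -> (composable a <-> composable b) ->
  (composable a -> a ≡ b) -> a ≡ b.
Proof.
move=> eL eT eB eR eC e; split=> //; split=> // p q.
by have [_ [_]] := e p; exact.
Qed.

(** The representatives of the boundaries can be chosen freely. Choosing them to match on the nose
    makes the corresponding constructor of [ceq] applicable. *)
Lemma diagram_cell (X : dmcat) (a : diagram X) (U : vexp X) (A B : X) (W : vexp X) :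
  veq (dleft a) U -> dtop a = A -> dbot a = B -> veq (dright a) W -> composable a ->
  exists a0 : cell U A B W, a ≡ ⟦a0⟧.
Proof.
move=> eU eA eB eW p; exists (ccast eU eA eB eW (diag_cell p)).
split=> //; split=> // q _ /=.
exact: ceq_trans (diag_cell_irr q p) (ceq_sym (ceq_cast _ _ _ _ _)).
Qed.

(** * The double category laws for diagrams *)

Lemma horA (X : dmcat) (a b c : diagram X) : a ∣ (b ∣ c) ≡ a ∣ b ∣ c.
Proof.
apply: deq_of_composable => /=; rewrite ?tensA //; try tauto.
move=> [p [[q [r e]] e']].
have [a0 ea] := diagram_cell veq_refl eq_refl eq_refl e' p.
have [b0 eb] := diagram_cell veq_refl eq_refl eq_refl e q.
have [c0 ec] := diagram_cell veq_refl eq_refl eq_refl veq_refl r.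
transitivity (⟦a0⟧ ∣ (⟦b0⟧ ∣ ⟦c0⟧)); first exact: hor_congr ea (hor_congr eb ec).
transitivity (⟦a0⟧ ∣ ⟦b0⟧ ∣ ⟦c0⟧); last by symmetry; exact: hor_congr (hor_congr ea eb) ec.
by rewrite -!cell_diag_hcomp; apply/cell_diag_eq; exact: ceq_hcompA.
Qed.

Lemma verA (X : dmcat) (a b c : diagram X) : a ⁄ (b ⁄ c) ≡ a ⁄ b ⁄ c.
Proof.
apply: deq_of_composable => /=; rewrite ?veq_tensA //; try tauto.
move=> [p [[q [r e]] e']].
have [a0 ea] := diagram_cell veq_refl eq_refl e' veq_refl p.
have [b0 eb] := diagram_cell veq_refl eq_refl e veq_refl q.
have [c0 ec] := diagram_cell veq_refl eq_refl eq_refl veq_refl r.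
transitivity (⟦a0⟧ ⁄ (⟦b0⟧ ⁄ ⟦c0⟧)); first exact: ver_congr ea (ver_congr eb ec).
transitivity (⟦a0⟧ ⁄ ⟦b0⟧ ⁄ ⟦c0⟧); last by symmetry; exact: ver_congr (ver_congr ea eb) ec.
by rewrite -!cell_diag_vcomp; apply/cell_diag_eq; exact: ceq_vcompA.
Qed.

Lemma hor1d (X : dmcat) (U : vexp X) (a : diagram X) :
  veq U (dleft a) -> ⟦cid U⟧ ∣ a ≡ a.
Proof.
move=> e; apply: deq_of_composable => /=; rewrite ?tens1o //; try tauto.
move=> [_ [p _]]; have [a0 ->] := diagram_cell (veq_sym e) eq_refl eq_refl veq_refl p.
by rewrite -cell_diag_hcomp; apply/cell_diag_eq; exact: ceq_hcomp1c.
Qed.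

Lemma hord1 (X : dmcat) (U : vexp X) (a : diagram X) :
  veq (dright a) U -> a ∣ ⟦cid U⟧ ≡ a.
Proof.
move=> e; apply: deq_of_composable => /=; [by []|exact: tenso1|exact: tenso1|by symmetry|tauto|].
move=> [p _]; have [a0 ->] := diagram_cell veq_refl eq_refl eq_refl e p.
by rewrite -cell_diag_hcomp; apply/cell_diag_eq; exact: ceq_hcompc1.
Qed.

Lemma ver1d (X : dmcat) (A : X) (a : diagram X) : A = dtop a -> ⟦cone A⟧ ⁄ a ≡ a.
Proof.
move=> e; apply: deq_of_composable => /=; rewrite ?veq_tens1v //; try tauto.
move=> [_ [p _]]; have [a0 ->] := diagram_cell veq_refl (eq_sym e) eq_refl veq_refl p.
by rewrite -cell_diag_vcomp; apply/cell_diag_eq; exact: ceq_vcomp1c.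
Qed.

Lemma verd1 (X : dmcat) (A : X) (a : diagram X) : dbot a = A -> a ⁄ ⟦cone A⟧ ≡ a.
Proof.
move=> e; apply: deq_of_composable => /=; rewrite ?veq_tensv1 //; try tauto.
move=> [p _]; have [a0 ->] := diagram_cell veq_refl eq_refl e veq_refl p.
by rewrite -cell_diag_vcomp; apply/cell_diag_eq; exact: ceq_vcompc1.
Qed.

Lemma interchange (X : dmcat) (a b c d : diagram X) :
  veq (dright a) (dleft c) -> veq (dright b) (dleft d) ->
  dbot a = dtop b -> dbot c = dtop d ->
  (a ⁄ b) ∣ (c ⁄ d) ≡ (a ∣ c) ⁄ (b ∣ d).
Proof.
(* The left side only asks that tensors of vertical edges agree, the right side only that tensors of
   objects agree, and neither implies agreement of the factors. Hence the four hypotheses, under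
   which both sides are composable exactly when all four cells are. *)
move=> eac ebd eab ecd; apply: deq_of_composable => //=.
  by rewrite eac ebd eab ecd; intuition reflexivity.
move=> [[p [q _]] [[r [s _]] _]].
have [a0 ea] := diagram_cell veq_refl eq_refl eab eac p.
have [b0 eb] := diagram_cell veq_refl eq_refl eq_refl ebd q.
have [c0 ec] := diagram_cell veq_refl eq_refl ecd veq_refl r.
have [d0 ed] := diagram_cell veq_refl eq_refl eq_refl veq_refl s.
transitivity ((⟦a0⟧ ⁄ ⟦b0⟧) ∣ (⟦c0⟧ ⁄ ⟦d0⟧)).
  exact: hor_congr (ver_congr ea eb) (ver_congr ec ed).
transitivity ((⟦a0⟧ ∣ ⟦c0⟧) ⁄ (⟦b0⟧ ∣ ⟦d0⟧)).
  rewrite -!cell_diag_vcomp -!cell_diag_hcomp -!cell_diag_vcomp.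
  by apply/cell_diag_eq; exact: ceq_interchange.
by symmetry; exact: ver_congr (hor_congr ea ec) (hor_congr eb ed).
Qed.

Ltac boundaries :=
  rewrite /= ?veq_tens1v ?veq_tensv1 ?tens1o ?tenso1 //.

(** Interchange with [c] padded by a vertical unit above it. The next three lemmas pad below, or pad
    a cell on the left. *)
Lemma hor_ver_top (X : dmcat) (a b c : diagram X) :
  veq (dright a) vone -> veq (dright b) (dleft c) -> dbot a = dtop b ->
  (a ⁄ b) ∣ c ≡ (a ∣ ⟦cone (dtop c)⟧) ⁄ (b ∣ c).
Proof. by move=> ea eb e; rewrite -interchange //= ver1d. Qed.

Lemma hor_ver_bot (X : dmcat) (a b c : diagram X) :
  veq (dright a) (dleft c) -> veq (dright b) vone -> dbot a = dtop b ->
  (a ⁄ b) ∣ c ≡ (a ∣ c) ⁄ (b ∣ ⟦cone (dbot c)⟧).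
Proof. by move=> ea eb e; rewrite -interchange //= verd1. Qed.

Lemma ver_hor_top (X : dmcat) (a b c : diagram X) :
  veq vone (dleft a) -> veq (dright c) (dleft b) -> dbot a = dtop b ->
  c ∣ (a ⁄ b) ≡ (⟦cone (dtop c)⟧ ∣ a) ⁄ (c ∣ b).
Proof. by move=> ea eb e; rewrite -interchange //= ver1d. Qed.

Lemma ver_hor_bot (X : dmcat) (a b c : diagram X) :
  veq (dright c) (dleft a) -> veq vone (dleft b) -> dbot a = dtop b ->
  c ∣ (a ⁄ b) ≡ (c ∣ a) ⁄ (⟦cone (dbot c)⟧ ∣ b).
Proof. by move=> ea eb e; rewrite -interchange //= verd1. Qed.

Lemma cone_unit (X : dmcat) : ⟦cone (@unit X)⟧ ≡ ⟦cid vone⟧.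
Proof. by apply/cell_diag_eq; exact: ceq_sym (ceq_cid_one _). Qed.

Lemma hor_cone_unit (X : dmcat) (a : diagram X) :
  veq (dright a) vone -> a ∣ ⟦cone unit⟧ ≡ a.
Proof. by move=> e; rewrite cone_unit hord1. Qed.

Lemma cone_unit_hor (X : dmcat) (a : diagram X) :
  veq vone (dleft a) -> ⟦cone unit⟧ ∣ a ≡ a.
Proof. by move=> e; rewrite cone_unit hor1d. Qed.

Lemma cell_diag_cone_tens (X : dmcat) (A B : X) :
  ⟦cone (A ⊗ B)⟧ ≡ ⟦cone A⟧ ∣ ⟦cone B⟧.
Proof. by rewrite -cell_diag_hcomp; apply/cell_diag_eq; exact: ceq_cone_tens. Qed.

(** * The braiding *)

Lemma cell_diag_comp (X : dmcat) (A B C : X) (f : hom A B) (g : hom B C) :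
  ⟦emb (comp f g)⟧ ≡ ⟦emb f⟧ ⁄ ⟦emb g⟧.
Proof. by rewrite -cell_diag_vcomp; apply/cell_diag_eq; exact: ceq_emb_comp. Qed.

Lemma cell_diag_tensm (X : dmcat) (A B A' B' : X) (f : hom A B) (g : hom A' B') :
  ⟦emb (tensm f g)⟧ ≡ ⟦emb f⟧ ∣ ⟦emb g⟧.
Proof. by rewrite -cell_diag_hcomp; apply/cell_diag_eq; exact: ceq_emb_tens. Qed.

Lemma cell_diag_idm (X : dmcat) (A : X) : ⟦emb (idm A)⟧ ≡ ⟦cone A⟧.
Proof. by apply/cell_diag_eq; exact: ceq_emb_id. Qed.

Lemma cell_diag_hcast (X : dmcat) (A A' B B' : X) (eA : A = A') (eB : B = B')
    (f : hom A B) :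
  ⟦emb (hcast eA eB f)⟧ ≡ ⟦emb f⟧.
Proof. by case: A' / eA; case: B' / eB. Qed.

Lemma braid_braid (X : dmcat) (A B : X) :
  ⟦emb (braid A B)⟧ ⁄ ⟦emb (braid B A)⟧ ≡ ⟦cone (A ⊗ B)⟧.
Proof. by rewrite -cell_diag_comp braid_sym cell_diag_idm. Qed.

Lemma braid_tens (X : dmcat) (A B C : X) :
  ⟦emb (braid (A ⊗ B) C)⟧ ≡
  (⟦cone A⟧ ∣ ⟦emb (braid B C)⟧) ⁄ (⟦emb (braid A C)⟧ ∣ ⟦cone B⟧).
Proof.
by rewrite braid_hexagon cell_diag_comp !cell_diag_hcast !cell_diag_tensm !cell_diag_idm.
Qed.

(** The hexagon at [unit ⊗ unit] makes this braiding idempotent, and symmetry makes it invertible;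
    an invertible idempotent is an identity. *)
Lemma braid_unit (X : dmcat) (C : X) : ⟦emb (braid unit C)⟧ ≡ ⟦cone C⟧.
Proof.
set s := ⟦emb (braid unit C)⟧.
have ss : s ≡ s ⁄ s.
  (* Replacing [unit] by the equal object [unit ⊗ unit] changes the type of the braiding, which [≡]
     tolerates. *)
  have e A : unit = A -> s ≡ ⟦emb (braid A C)⟧ by move=> <-.
  by rewrite {1}(e _ (eq_sym (tens1o unit))) braid_tens cone_unit_hor // hor_cone_unit.
have st : s ⁄ ⟦emb (braid C unit)⟧ ≡ ⟦cone C⟧.
  by rewrite braid_braid tens1o.
transitivity (s ⁄ ⟦cone C⟧); first by rewrite verd1 //= tenso1.
by rewrite -{1}st verA -ss.
Qed.

(** * Universal properties *)

Lemma hor_cpair0 (X : dmcat) (V : vexp X) (A B : X) (U W : vexp X) (a : cell V A B U)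
    (b : cell V A B W) :
  ⟦cpair a b⟧ ∣ ⟦cproj0 U W⟧ ≡ ⟦a⟧.
Proof. by rewrite -cell_diag_hcomp; apply/cell_diag_eq; exact: ceq_cpair0. Qed.

Lemma hor_cpair1 (X : dmcat) (V : vexp X) (A B : X) (U W : vexp X) (a : cell V A B U)
    (b : cell V A B W) :
  ⟦cpair a b⟧ ∣ ⟦cproj1 U W⟧ ≡ ⟦b⟧.
Proof. by rewrite -cell_diag_hcomp; apply/cell_diag_eq; exact: ceq_cpair1. Qed.

Lemma hor_ccase0 (X : dmcat) (U W : vexp X) (A B : X) (V : vexp X) (a : cell U A B V)
    (b : cell W A B V) :
  ⟦cinj0 U W⟧ ∣ ⟦ccase a b⟧ ≡ ⟦a⟧.
Proof. by rewrite -cell_diag_hcomp; apply/cell_diag_eq; exact: ceq_ccase0. Qed.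

Lemma hor_ccase1 (X : dmcat) (U W : vexp X) (A B : X) (V : vexp X) (a : cell U A B V)
    (b : cell W A B V) :
  ⟦cinj1 U W⟧ ∣ ⟦ccase a b⟧ ≡ ⟦b⟧.
Proof. by rewrite -cell_diag_hcomp; apply/cell_diag_eq; exact: ceq_ccase1. Qed.

Lemma ver_ccopair0 (X : dmcat) (U : vexp X) (A B C : X) (W : vexp X) (a : cell U A C W)
    (b : cell U B C W) :
  ⟦emb (inj0 A B)⟧ ⁄ ⟦ccopair a b⟧ ≡ ⟦a⟧.
Proof. by rewrite -cell_diag_vcomp; apply/cell_diag_eq; exact: ceq_ccopair0. Qed.

Lemma ver_ccopair1 (X : dmcat) (U : vexp X) (A B C : X) (W : vexp X) (a : cell U A C W)
    (b : cell U B C W) :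
  ⟦emb (inj1 A B)⟧ ⁄ ⟦ccopair a b⟧ ≡ ⟦b⟧.
Proof. by rewrite -cell_diag_vcomp; apply/cell_diag_eq; exact: ceq_ccopair1. Qed.

Lemma hor_iterX0 (X : dmcat) (V : vexp X) (A : X) (U W : vexp X) (B : X) (K : vexp X)
    (a : cell V A A U) (f : cell W A B K) (g : cell W unit unit (V ⊗ W)) :
  ⟦iterX a f g⟧ ∣ (⟦projX0 U⟧ ⁄ ⟦cid K⟧) ≡ ⟦f⟧.
Proof.
by rewrite -cell_diag_vcomp -cell_diag_hcomp; apply/cell_diag_eq; exact: ceq_iterX0.
Qed.

Lemma hor_iterX1 (X : dmcat) (V : vexp X) (A : X) (U W : vexp X) (B : X) (K : vexp X)
    (a : cell V A A U) (f : cell W A B K) (g : cell W unit unit (V ⊗ W)) :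
  ⟦iterX a f g⟧ ∣ (⟦projX1 U⟧ ⁄ ⟦cid K⟧) ≡ ⟦g⟧ ∣ (⟦a⟧ ⁄ ⟦iterX a f g⟧).
Proof.
rewrite -!cell_diag_vcomp -!cell_diag_hcomp.
by apply/cell_diag_eq; exact: ceq_iterX1.
Qed.

Lemma hor_iterP0 (X : dmcat) (U : vexp X) (A : X) (V K : vexp X) (B : X) (W : vexp X)
    (a : cell U A A V) (f : cell K A B W) (g : cell (V ⊗ W) unit unit W) :
  (⟦injP0 U⟧ ⁄ ⟦cid K⟧) ∣ ⟦iterP a f g⟧ ≡ ⟦f⟧.
Proof.
by rewrite -cell_diag_vcomp -cell_diag_hcomp; apply/cell_diag_eq; exact: ceq_iterP0.
Qed.

Lemma hor_iterP1 (X : dmcat) (U : vexp X) (A : X) (V K : vexp X) (B : X) (W : vexp X)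
    (a : cell U A A V) (f : cell K A B W) (g : cell (V ⊗ W) unit unit W) :
  (⟦injP1 U⟧ ⁄ ⟦cid K⟧) ∣ ⟦iterP a f g⟧ ≡ (⟦a⟧ ⁄ ⟦iterP a f g⟧) ∣ ⟦g⟧.
Proof.
rewrite -!cell_diag_vcomp -!cell_diag_hcomp.
by apply/cell_diag_eq; exact: ceq_iterP1.
Qed.

Lemma iterX_unique (X : dmcat) (V : vexp X) (A : X) (U W : vexp X) (B : X) (K : vexp X)
    (a : cell V A A U) (f : cell W A B K) (g : cell W unit unit (V ⊗ W))
    (h : cell W A B (U^× ⊗ K)) :
  ⟦h⟧ ∣ (⟦projX0 U⟧ ⁄ ⟦cid K⟧) ≡ ⟦f⟧ ->
  ⟦h⟧ ∣ (⟦projX1 U⟧ ⁄ ⟦cid K⟧) ≡ ⟦g⟧ ∣ (⟦a⟧ ⁄ ⟦h⟧) ->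
  h ≈ iterX a f g.
Proof.
rewrite -!cell_diag_vcomp -!cell_diag_hcomp => /cell_diag_eq e0 /cell_diag_eq e1.
exact: ceq_iterX_uniq.
Qed.

Lemma iterP_unique (X : dmcat) (U : vexp X) (A : X) (V K : vexp X) (B : X) (W : vexp X)
    (a : cell U A A V) (f : cell K A B W) (g : cell (V ⊗ W) unit unit W)
    (h : cell (U^+ ⊗ K) A B W) :
  (⟦injP0 U⟧ ⁄ ⟦cid K⟧) ∣ ⟦h⟧ ≡ ⟦f⟧ ->
  (⟦injP1 U⟧ ⁄ ⟦cid K⟧) ∣ ⟦h⟧ ≡ (⟦a⟧ ⁄ ⟦h⟧) ∣ ⟦g⟧ ->
  h ≈ iterP a f g.
Proof.
rewrite -!cell_diag_vcomp -!cell_diag_hcomp => /cell_diag_eq e0 /cell_diag_eq e1.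
exact: ceq_iterP_uniq.
Qed.

(** Both cells satisfy the uniqueness clause for the pairing of the components of [k]. The casts in
    [k0] and [k1] remove the unit object contributed by the projections. *)
Lemma cpair_ext (X : dmcat) (V : vexp X) (A B : X) (U W : vexp X)
    (h k : cell V A B (U × W)) :
  ⟦h⟧ ∣ ⟦cproj0 U W⟧ ≡ ⟦k⟧ ∣ ⟦cproj0 U W⟧ ->
  ⟦h⟧ ∣ ⟦cproj1 U W⟧ ≡ ⟦k⟧ ∣ ⟦cproj1 U W⟧ -> h ≈ k.
Proof.
move=> e0 e1.
pose k0 := ccast veq_refl (tenso1 A) (tenso1 B) veq_refl (hcomp k (cproj0 U W)).
pose k1 := ccast veq_refl (tenso1 A) (tenso1 B) veq_refl (hcomp k (cproj1 U W)).
apply: (@ceq_trans _ _ _ _ _ _ _ _ _ _ (cpair k0 k1)).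
  by apply: ceq_cpair_uniq; apply/cell_diag_eq; rewrite cell_diag_cast !cell_diag_hcomp.
by apply: ceq_sym; apply: ceq_cpair_uniq; apply/cell_diag_eq; rewrite cell_diag_cast.
Qed.

Lemma ccase_ext (X : dmcat) (U W : vexp X) (A B : X) (V : vexp X)
    (h k : cell (U + W) A B V) :
  ⟦cinj0 U W⟧ ∣ ⟦h⟧ ≡ ⟦cinj0 U W⟧ ∣ ⟦k⟧ ->
  ⟦cinj1 U W⟧ ∣ ⟦h⟧ ≡ ⟦cinj1 U W⟧ ∣ ⟦k⟧ -> h ≈ k.
Proof.
move=> e0 e1.
pose k0 := ccast veq_refl (tens1o A) (tens1o B) veq_refl (hcomp (cinj0 U W) k).
pose k1 := ccast veq_refl (tens1o A) (tens1o B) veq_refl (hcomp (cinj1 U W) k).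
apply: (@ceq_trans _ _ _ _ _ _ _ _ _ _ (ccase k0 k1)).
  by apply: ceq_ccase_uniq; apply/cell_diag_eq; rewrite cell_diag_cast !cell_diag_hcomp.
by apply: ceq_sym; apply: ceq_ccase_uniq; apply/cell_diag_eq; rewrite cell_diag_cast.
Qed.

Lemma ccopair_ext (X : dmcat) (U : vexp X) (A B C : X) (W : vexp X)
    (h k : cell U (A ⊕ B)%obj C W) :
  ⟦emb (inj0 A B)⟧ ⁄ ⟦h⟧ ≡ ⟦emb (inj0 A B)⟧ ⁄ ⟦k⟧ ->
  ⟦emb (inj1 A B)⟧ ⁄ ⟦h⟧ ≡ ⟦emb (inj1 A B)⟧ ⁄ ⟦k⟧ -> h ≈ k.
Proof.
move=> e0 e1.
pose k0 := ccast veq_tens1v eq_refl eq_refl veq_tens1v (vcomp (emb (inj0 A B)) k).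
pose k1 := ccast veq_tens1v eq_refl eq_refl veq_tens1v (vcomp (emb (inj1 A B)) k).
apply: (@ceq_trans _ _ _ _ _ _ _ _ _ _ (ccopair k0 k1)).
  by apply: ceq_ccopair_uniq; apply/cell_diag_eq; rewrite cell_diag_cast !cell_diag_vcomp.
by apply: ceq_sym; apply: ceq_ccopair_uniq; apply/cell_diag_eq; rewrite cell_diag_cast.
Qed.

Lemma copair_tens_ext (X : dmcat) (U : vexp X) (A B C D : X) (W : vexp X)
    (h k : cell U ((A ⊕ B) ⊗ C)%obj D W) :
  (⟦emb (inj0 A B)⟧ ∣ ⟦cone C⟧) ⁄ ⟦h⟧ ≡ (⟦emb (inj0 A B)⟧ ∣ ⟦cone C⟧) ⁄ ⟦k⟧ ->
  (⟦emb (inj1 A B)⟧ ∣ ⟦cone C⟧) ⁄ ⟦h⟧ ≡ (⟦emb (inj1 A B)⟧ ∣ ⟦cone C⟧) ⁄ ⟦k⟧ ->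
  h ≈ k.
Proof.
move=> e0 e1.
set d := copair (tensm (inj0 A B) (idm C)) (tensm (inj1 A B) (idm C)).
have [d' [_ d'd]] : is_iso d := distributive A B C.
(* The source of [d] is a coproduct, and its composites with the injections are the two cells of the
   hypotheses. *)
have ed : ⟦emb d⟧ ⁄ ⟦h⟧ ≡ ⟦emb d⟧ ⁄ ⟦k⟧.
  rewrite -!cell_diag_vcomp.
  rewrite -(cell_diag_cast veq_tens1v eq_refl eq_refl veq_tens1v (vcomp _ h)).
  rewrite -(cell_diag_cast veq_tens1v eq_refl eq_refl veq_tens1v (vcomp _ k)).
  apply/cell_diag_eq; apply: ccopair_ext; rewrite !cell_diag_cast !cell_diag_vcomp !verA;
    rewrite -!cell_diag_comp /d ?copair0 ?copair1 cell_diag_tensm cell_diag_idm //.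
apply/cell_diag_eq.
(* Distributivity enters here: the inverse [d'] cancels [d]. *)
have e (l : cell U ((A ⊕ B) ⊗ C)%obj D W) : ⟦l⟧ ≡ ⟦emb d'⟧ ⁄ (⟦emb d⟧ ⁄ ⟦l⟧).
  by rewrite verA -cell_diag_comp d'd cell_diag_idm ver1d.
by rewrite (e h) ed -e.
Qed.

(** * Crossing cells *)

Lemma chi_circ (X : dmcat) (A C : X) :
  ⟦chi A^∘ C⟧ ≡
  (⟦getL A⟧ ∣ ⟦cone C⟧) ⁄ ⟦emb (braid A C)⟧ ⁄ (⟦cone C⟧ ∣ ⟦putR A⟧).
Proof. by rewrite /= cell_diag_cast !cell_diag_vcomp !cell_diag_hcomp. Qed.

Lemma chi_bullet (X : dmcat) (A C : X) :
  ⟦chi A^• C⟧ ≡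
  (⟦cone C⟧ ∣ ⟦getR A⟧) ⁄ ⟦emb (braid C A)⟧ ⁄ (⟦putL A⟧ ∣ ⟦cone C⟧).
Proof. by rewrite /= cell_diag_cast !cell_diag_vcomp !cell_diag_hcomp. Qed.

Lemma chi_tens (X : dmcat) (U W : vexp X) (C : X) :
  ⟦chi (U ⊗ W) C⟧ ≡ ⟦chi U C⟧ ⁄ ⟦chi W C⟧.
Proof. by rewrite /= cell_diag_vcomp. Qed.

Lemma chi_cproj0 (X : dmcat) (U W : vexp X) (C : X) :
  ⟦chi (U × W) C⟧ ∣ ⟦cproj0 U W⟧ ≡ ⟦cproj0 U W⟧ ∣ ⟦chi U C⟧.
Proof. by rewrite /= cell_diag_cast hor_cpair0 cell_diag_hcomp. Qed.

Lemma chi_cproj1 (X : dmcat) (U W : vexp X) (C : X) :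
  ⟦chi (U × W) C⟧ ∣ ⟦cproj1 U W⟧ ≡ ⟦cproj1 U W⟧ ∣ ⟦chi W C⟧.
Proof. by rewrite /= cell_diag_cast hor_cpair1 cell_diag_hcomp. Qed.

Lemma chi_cinj0 (X : dmcat) (U W : vexp X) (C : X) :
  ⟦cinj0 U W⟧ ∣ ⟦chi (U + W) C⟧ ≡ ⟦chi U C⟧ ∣ ⟦cinj0 U W⟧.
Proof. by rewrite /= cell_diag_cast hor_ccase0 cell_diag_hcomp. Qed.

Lemma chi_cinj1 (X : dmcat) (U W : vexp X) (C : X) :
  ⟦cinj1 U W⟧ ∣ ⟦chi (U + W) C⟧ ≡ ⟦chi W C⟧ ∣ ⟦cinj1 U W⟧.
Proof. by rewrite /= cell_diag_cast hor_ccase1 cell_diag_hcomp. Qed.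

(** [iterXs] is [iterX] with [K] equal to [vone], so its equations carry this extra identity
    cell. *)
Lemma projX_vone (X : dmcat) (U : vexp X) :
  ⟦projX0 U⟧ ⁄ ⟦cid vone⟧ ≡ ⟦projX0 U⟧ /\ ⟦projX1 U⟧ ⁄ ⟦cid vone⟧ ≡ ⟦projX1 U⟧.
Proof. by rewrite -cone_unit !verd1. Qed.

Lemma injP_vone (X : dmcat) (U : vexp X) :
  ⟦injP0 U⟧ ⁄ ⟦cid vone⟧ ≡ ⟦injP0 U⟧ /\ ⟦injP1 U⟧ ⁄ ⟦cid vone⟧ ≡ ⟦injP1 U⟧.
Proof. by rewrite -cone_unit !verd1. Qed.

Lemma iterXs_projX0 (X : dmcat) (U : vexp X) (A : X) (W : vexp X) (a : cell U A A W) :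
  ⟦iterXs a⟧ ∣ ⟦projX0 W⟧ ≡ ⟦projX0 U⟧ ∣ ⟦cone A⟧.
Proof.
rewrite cell_diag_cast -(proj1 (projX_vone W)) hor_iterX0.
by rewrite cell_diag_cast cell_diag_hcomp.
Qed.

Lemma iterXs_projX1 (X : dmcat) (U : vexp X) (A : X) (W : vexp X) (a : cell U A A W) :
  ⟦iterXs a⟧ ∣ ⟦projX1 W⟧ ≡ ⟦projX1 U⟧ ∣ (⟦a⟧ ⁄ ⟦iterXs a⟧).
Proof. by rewrite cell_diag_cast -{1}(proj2 (projX_vone W)) hor_iterX1. Qed.

Lemma iterPs_injP0 (X : dmcat) (U : vexp X) (A : X) (W : vexp X) (a : cell U A A W) :
  ⟦injP0 U⟧ ∣ ⟦iterPs a⟧ ≡ ⟦cone A⟧ ∣ ⟦injP0 W⟧.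
Proof.
rewrite [⟦iterPs a⟧]cell_diag_cast -(proj1 (injP_vone U)) hor_iterP0.
by rewrite cell_diag_cast cell_diag_hcomp.
Qed.

Lemma iterPs_injP1 (X : dmcat) (U : vexp X) (A : X) (W : vexp X) (a : cell U A A W) :
  ⟦injP1 U⟧ ∣ ⟦iterPs a⟧ ≡ (⟦a⟧ ⁄ ⟦iterPs a⟧) ∣ ⟦injP1 W⟧.
Proof.
by rewrite [⟦iterPs a⟧]cell_diag_cast -{1}(proj2 (injP_vone U)) hor_iterP1.
Qed.

Lemma iterXs_congr (X : dmcat) (U U' W W' : vexp X) (A A' : X) (a : cell U A A W)
    (a' : cell U' A' A' W') :
  a ≈ a' -> iterXs a ≈ iterXs a'.
Proof.
move=> e; have [eU [eA [_ eW]]] := ceq_boundary e; case: A' / eA a' e => a' e.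
apply/cell_diag_eq; rewrite !cell_diag_cast; apply/cell_diag_eq; apply: ceq_iterX => //.
  apply/cell_diag_eq; rewrite !cell_diag_cast !cell_diag_hcomp !cell_diag_cast.
  apply: hor_congr => //; apply/cell_diag_eq; apply: ceq_cproj0 => //.
  by apply: veq_tens => //; exact: veq_itX.
apply/cell_diag_eq; rewrite !cell_diag_cast; apply/cell_diag_eq; apply: ceq_cproj1 => //.
by apply: veq_tens => //; exact: veq_itX.
Qed.

Lemma iterPs_congr (X : dmcat) (U U' W W' : vexp X) (A A' : X) (a : cell U A A W)
    (a' : cell U' A' A' W') :
  a ≈ a' -> iterPs a ≈ iterPs a'.
Proof.
move=> e; have [eU [eA [_ eW]]] := ceq_boundary e; case: A' / eA a' e => a' e.
apply/cell_diag_eq; rewrite !cell_diag_cast; apply/cell_diag_eq; apply: ceq_iterP => //.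
  apply/cell_diag_eq; rewrite !cell_diag_cast !cell_diag_hcomp !cell_diag_cast.
  apply: hor_congr => //; apply/cell_diag_eq; apply: ceq_cinj0 => //.
  by apply: veq_tens => //; exact: veq_itP.
apply/cell_diag_eq; rewrite !cell_diag_cast; apply/cell_diag_eq; apply: ceq_cinj1 => //.
by apply: veq_tens => //; exact: veq_itP.
Qed.

(** By induction on the derivation: apart from the equivalence rules, there are congruences, laws of
    vertical composition, and the two unfoldings. *)
Lemma chi_veq (X : dmcat) (U U' : vexp X) (C : X) :
  veq U U' -> ⟦chi U C⟧ ≡ ⟦chi U' C⟧.
Proof.
move=> e; apply/cell_diag_eq.
elim: e => {U U'}.
- by [].
- by move=> U W _ e; apply: ceq_sym.
- by move=> U V W _ e1 _ e2; apply: ceq_trans e1 e2.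
- by move=> U U' W W' _ e1 _ e2; apply: ceq_vcomp.
- move=> U U' W W' eU e1 eW e2; apply/cell_diag_eq; rewrite !cell_diag_cast.
  apply/cell_diag_eq; apply: ceq_cpair; apply: ceq_hcomp => //.
    exact: ceq_cproj0.
  exact: ceq_cproj1.
- move=> U U' W W' eU e1 eW e2; apply/cell_diag_eq; rewrite !cell_diag_cast.
  apply/cell_diag_eq; apply: ceq_ccase; apply: ceq_hcomp => //.
    exact: ceq_cinj0.
  exact: ceq_cinj1.
- by move=> U U' _ e; exact: iterXs_congr.
- by move=> U U' _ e; exact: iterPs_congr.
- by move=> U V W; exact: ceq_vcompA.
- by move=> U; exact: ceq_vcomp1c.
- by move=> U; exact: ceq_vcompc1.
- move=> U; apply/cell_diag_eq.
  (* Recasting the iterated crossing to a boundary that is syntactically a product lets [cpair_ext]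
     apply. Recasting the projections then turns them into [projX0] and [projX1]. *)
  rewrite -(cell_diag_cast veq_unfoldX eq_refl eq_refl veq_unfoldX).
  apply/cell_diag_eq; apply: cpair_ext.
    rewrite chi_cproj0 (cell_diag_cast veq_unfoldX).
    rewrite -(cell_diag_cast (veq_sym veq_unfoldX) eq_refl eq_refl veq_refl (cproj0 _ _)).
    exact: iterXs_projX0 (chi U C).
  rewrite chi_cproj1 (cell_diag_cast veq_unfoldX) chi_tens.
  rewrite -(cell_diag_cast (veq_sym veq_unfoldX) eq_refl eq_refl veq_refl (cproj1 _ _)).
  exact: iterXs_projX1 (chi U C).
- move=> U; apply/cell_diag_eq.
  rewrite -(cell_diag_cast veq_unfoldP eq_refl eq_refl veq_unfoldP).
  apply/cell_diag_eq; apply: ccase_ext.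
    rewrite chi_cinj0 (cell_diag_cast veq_unfoldP).
    rewrite -(cell_diag_cast veq_refl eq_refl eq_refl (veq_sym veq_unfoldP) (cinj0 _ _)).
    exact: iterPs_injP0 (chi U C).
  rewrite chi_cinj1 (cell_diag_cast veq_unfoldP) chi_tens.
  rewrite -(cell_diag_cast veq_refl eq_refl eq_refl (veq_sym veq_unfoldP) (cinj1 _ _)).
  exact: iterPs_injP1 (chi U C).
Qed.

(** * Sliding a cell past a crossing *)

(** This and [slide_top] are the two sides of the equation, cast to one common boundary because the
    extensionality and uniqueness lemmas compare cells of a single type. *)
Definition slide_bot (X : dmcat) (C : X) (U W : vexp X) (A B : X) (a : cell U A B W) :
    cell U (A ⊗ C)%obj (C ⊗ B)%obj W :=
  ccast veq_tensv1 eq_refl eq_refl veq_tensv1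
    (vcomp (hcomp a (chi W C)) (emb (braid B C))).

Definition slide_top (X : dmcat) (C : X) (U W : vexp X) (A B : X) (a : cell U A B W) :
    cell U (A ⊗ C)%obj (C ⊗ B)%obj W :=
  ccast veq_tens1v eq_refl eq_refl veq_tens1v
    (vcomp (emb (braid A C)) (hcomp (chi U C) a)).

Lemma slide_botE (X : dmcat) (C : X) (U W : vexp X) (A B : X) (a : cell U A B W) :
  ⟦slide_bot C a⟧ ≡ ⟦a⟧ ∣ ⟦chi W C⟧ ⁄ ⟦emb (braid B C)⟧.
Proof. by rewrite cell_diag_cast cell_diag_vcomp cell_diag_hcomp. Qed.

Lemma slide_topE (X : dmcat) (C : X) (U W : vexp X) (A B : X) (a : cell U A B W) :
  ⟦slide_top C a⟧ ≡ ⟦emb (braid A C)⟧ ⁄ (⟦chi U C⟧ ∣ ⟦a⟧).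
Proof. by rewrite cell_diag_cast cell_diag_vcomp cell_diag_hcomp. Qed.

Definition slides (X : dmcat) (U : vexp X) (A B : X) (W : vexp X) (a : cell U A B W) :=
  forall C : X,
    ⟦a⟧ ∣ ⟦chi W C⟧ ⁄ ⟦emb (braid B C)⟧ ≡ ⟦emb (braid A C)⟧ ⁄ (⟦chi U C⟧ ∣ ⟦a⟧).

(** * Casts, units, composites and embedded morphisms *)

Lemma slides_ccast (X : dmcat) (U U' : vexp X) (A A' B B' : X) (W W' : vexp X)
    (eU : veq U U') (eA : A = A') (eB : B = B') (eW : veq W W') (a : cell U A B W) :
  slides a -> slides (ccast eU eA eB eW a).
Proof.
case: A' / eA; case: B' / eB => sa C.
by rewrite cell_diag_cast -(chi_veq C eU) -(chi_veq C eW).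
Qed.

Lemma slides_cid (X : dmcat) (U : vexp X) : slides (cid U).
Proof. by move=> C; rewrite hor1d // hord1 // braid_unit verd1 // ver1d. Qed.

Lemma slides_cone (X : dmcat) (A : X) : slides (cone A).
Proof.
move=> C; rewrite /= -!cell_diag_cone_tens.
by rewrite ver1d // verd1.
Qed.

Lemma slides_hcomp (X : dmcat) (U : vexp X) (A B : X) (V : vexp X) (A' B' : X)
    (W : vexp X) (a : cell U A B V) (b : cell V A' B' W) :
  slides a -> slides b -> slides (hcomp a b).
Proof.
move=> sa sb C; rewrite !braid_tens !cell_diag_hcomp.
rewrite verA -horA -interchange //= verd1 // sb.
(* Sliding [b] through the first factor of the hexagon has put [chi V C] to the right of [a], where
   [sa] expects it; [a] then slides through the second factor. *)
rewrite ver_hor_top //= -verA horA -interchange //= sa verd1 //.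
by rewrite hor_ver_top //= verA horA.
Qed.

Lemma slides_vcomp (X : dmcat) (U : vexp X) (A D : X) (W U' : vexp X) (B : X)
    (W' : vexp X) (a : cell U A D W) (b : cell U' D B W') :
  slides a -> slides b -> slides (vcomp a b).
Proof.
move=> sa sb C; rewrite cell_diag_vcomp !chi_tens.
by rewrite !interchange // -verA sb verA sa -verA.
Qed.

Lemma braid_emb (X : dmcat) (A B C : X) (f : hom A B) :
  (⟦emb f⟧ ∣ ⟦cone C⟧) ⁄ ⟦emb (braid B C)⟧ ≡ ⟦emb (braid A C)⟧ ⁄ (⟦cone C⟧ ∣ ⟦emb f⟧).
Proof.
by rewrite -cell_diag_idm -!cell_diag_tensm -!cell_diag_comp braid_nat.
Qed.

Lemma slides_emb (X : dmcat) (A B : X) (f : hom A B) : slides (emb f).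
Proof. by move=> C; exact: braid_emb. Qed.

(** * Corner cells *)

Lemma putR_getL (X : dmcat) (A : X) : ⟦putR A⟧ ∣ ⟦getL A⟧ ≡ ⟦cone A⟧.
Proof. by rewrite -cell_diag_hcomp; apply/cell_diag_eq; exact: ceq_putR_getL. Qed.

Lemma getR_putL (X : dmcat) (A : X) : ⟦getR A⟧ ∣ ⟦putL A⟧ ≡ ⟦cone A⟧.
Proof. by rewrite -cell_diag_hcomp; apply/cell_diag_eq; exact: ceq_getR_putL. Qed.

(** The [putR A] at the bottom of the crossing cell meets [getL A] and straightens to an identity;
    what remains of the crossing is the left side. *)
Lemma slides_getL (X : dmcat) (A : X) : slides (getL A).
Proof.
move=> C; rewrite chi_circ braid_unit /= ver1d; first by boundaries.
rewrite hor_ver_top; [by boundaries..|].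
rewrite /= hor_cone_unit; first by boundaries.
rewrite -horA putR_getL.
by rewrite -cell_diag_cone_tens verd1.
Qed.

Lemma slides_putR (X : dmcat) (A : X) : slides (putR A).
Proof.
move=> C; rewrite chi_circ braid_unit /= verd1; first by boundaries.
rewrite !ver_hor_bot; [by boundaries..|].
rewrite /= !cone_unit_hor; [by boundaries..|].
rewrite horA putR_getL.
by rewrite -cell_diag_cone_tens ver1d.
Qed.

(** For [A^•] the crossing contains the braiding opposite to the one in the equation, so after
    straightening the two cancel by symmetry. The same happens for [putL]. *)
Lemma slides_getR (X : dmcat) (A : X) : slides (getR A).
Proof.
move=> C; rewrite chi_bullet braid_unit /= ver1d; first by boundaries.
rewrite ver_hor_top; [by boundaries..|].
rewrite /= cone_unit_hor; first by boundaries.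
rewrite horA getR_putL.
by rewrite -cell_diag_cone_tens -!verA ver1d // braid_braid verd1.
Qed.

Lemma slides_putL (X : dmcat) (A : X) : slides (putL A).
Proof.
move=> C; rewrite chi_bullet braid_unit /= verd1; first by boundaries.
rewrite !hor_ver_bot; [by boundaries..|].
rewrite /= !hor_cone_unit; [by boundaries..|].
rewrite -horA getR_putL.
by rewrite -cell_diag_cone_tens ver1d // verA braid_braid ver1d; first by boundaries.
Qed.

(** * Cells given by products and coproducts *)

Lemma slides_cproj0 (X : dmcat) (U W : vexp X) : slides (cproj0 U W).
Proof.
move=> C; rewrite !braid_unit ver1d ?verd1; [by boundaries..|].
by rewrite chi_cproj0.
Qed.

Lemma slides_cproj1 (X : dmcat) (U W : vexp X) : slides (cproj1 U W).
Proof.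
move=> C; rewrite !braid_unit ver1d ?verd1; [by boundaries..|].
by rewrite chi_cproj1.
Qed.

Lemma slides_cinj0 (X : dmcat) (U W : vexp X) : slides (cinj0 U W).
Proof.
move=> C; rewrite !braid_unit ver1d ?verd1; [by boundaries..|].
by rewrite chi_cinj0.
Qed.

Lemma slides_cinj1 (X : dmcat) (U W : vexp X) : slides (cinj1 U W).
Proof.
move=> C; rewrite !braid_unit ver1d ?verd1; [by boundaries..|].
by rewrite chi_cinj1.
Qed.

(** For [c] with trivial top the padding disappears. Together with its three variants, this lets
    projections and injections pass the braiding. *)
Lemma ver_hor_right (X : dmcat) (a b c : diagram X) :
  veq (dright a) vone -> veq (dright b) (dleft c) -> dbot a = dtop b ->
  dtop c = unit -> (a ⁄ b) ∣ c ≡ a ⁄ (b ∣ c).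
Proof. by move=> ea eb e ec; rewrite hor_ver_top // ec hor_cone_unit. Qed.

Lemma ver_hor_right_bot (X : dmcat) (a b c : diagram X) :
  veq (dright a) (dleft c) -> veq (dright b) vone -> dbot a = dtop b ->
  dbot c = unit -> (a ⁄ b) ∣ c ≡ (a ∣ c) ⁄ b.
Proof. by move=> ea eb e ec; rewrite hor_ver_bot // ec hor_cone_unit. Qed.

Lemma ver_hor_left (X : dmcat) (a b c : diagram X) :
  veq vone (dleft a) -> veq (dright c) (dleft b) -> dbot a = dtop b ->
  dtop c = unit -> c ∣ (a ⁄ b) ≡ a ⁄ (c ∣ b).
Proof. by move=> ea eb e ec; rewrite ver_hor_top // ec cone_unit_hor. Qed.

Lemma ver_hor_left_bot (X : dmcat) (a b c : diagram X) :
  veq (dright c) (dleft a) -> veq vone (dleft b) -> dbot a = dtop b ->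
  dbot c = unit -> c ∣ (a ⁄ b) ≡ (c ∣ a) ⁄ b.
Proof. by move=> ea eb e ec; rewrite ver_hor_bot // ec cone_unit_hor. Qed.

Lemma slides_cpair (X : dmcat) (V : vexp X) (A B : X) (U W : vexp X) (a : cell V A B U)
    (b : cell V A B W) :
  slides a -> slides b -> slides (cpair a b).
Proof.
move=> sa sb C; rewrite -slide_botE -slide_topE; apply/cell_diag_eq.
apply: cpair_ext; rewrite slide_botE slide_topE.
  rewrite ver_hor_right_bot // ver_hor_right // -!horA chi_cproj0 hor_cpair0.
  by rewrite horA hor_cpair0.
rewrite ver_hor_right_bot // ver_hor_right // -!horA chi_cproj1 hor_cpair1.
by rewrite horA hor_cpair1.
Qed.

Lemma slides_ccase (X : dmcat) (U W : vexp X) (A B : X) (V : vexp X) (a : cell U A B V)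
    (b : cell W A B V) :
  slides a -> slides b -> slides (ccase a b).
Proof.
move=> sa sb C; rewrite -slide_botE -slide_topE; apply/cell_diag_eq.
apply: ccase_ext; rewrite slide_botE slide_topE.
  rewrite ver_hor_left_bot // ver_hor_left // !horA chi_cinj0 hor_ccase0.
  by rewrite -horA hor_ccase0.
rewrite ver_hor_left_bot // ver_hor_left // !horA chi_cinj1 hor_ccase1.
by rewrite -horA hor_ccase1.
Qed.

Lemma slides_ccopair (X : dmcat) (U : vexp X) (A B D : X) (W : vexp X)
    (a : cell U A D W) (b : cell U B D W) :
  slides a -> slides b -> slides (ccopair a b).
Proof.
move=> sa sb C; rewrite -slide_botE -slide_topE; apply/cell_diag_eq.
(* Naturality of the braiding moves the injection below it on the right side, where it can reach the
   copairing. *)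
apply: copair_tens_ext; rewrite slide_botE slide_topE !verA braid_emb -interchange //.
  by rewrite ver1d // -verA -interchange // ver1d // ver_ccopair0.
by rewrite ver1d // -verA -interchange // ver1d // ver_ccopair1.
Qed.

(** * Iteration *)

Lemma slides_unit (X : dmcat) (U W : vexp X) (C : X) (a : cell U unit unit W) :
  slides a -> ⟦a⟧ ∣ ⟦chi W C⟧ ≡ ⟦chi U C⟧ ∣ ⟦a⟧.
Proof.
(* Both braidings involve the unit object and are identities. *)
by move/(_ C); rewrite !braid_unit verd1 ?ver1d; [by boundaries..|].
Qed.

(** This and the next three lemmas carry the projections and injections that characterise an
    iteration past the crossing cell of its boundary. *)
Lemma chi_projX0 (X : dmcat) (U K : vexp X) (C : X) :
  ⟦chi (U^× ⊗ K) C⟧ ∣ (⟦projX0 U⟧ ⁄ ⟦cid K⟧) ≡ (⟦projX0 U⟧ ⁄ ⟦cid K⟧) ∣ ⟦chi K C⟧.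
Proof.
rewrite chi_tens interchange //= iterXs_projX0 hord1 // -{1}(@hor1d _ K ⟦chi K C⟧) //.
by rewrite -interchange // ver1d.
Qed.

Lemma chi_projX1 (X : dmcat) (U K : vexp X) (C : X) :
  ⟦chi (U^× ⊗ K) C⟧ ∣ (⟦projX1 U⟧ ⁄ ⟦cid K⟧) ≡
  (⟦projX1 U⟧ ⁄ ⟦cid K⟧) ∣ (⟦chi U C⟧ ⁄ ⟦chi (U^× ⊗ K) C⟧).
Proof.
rewrite !chi_tens verA !interchange //=; rewrite iterXs_projX1.
by rewrite hord1 // hor1d.
Qed.

Lemma chi_injP0 (X : dmcat) (U K : vexp X) (C : X) :
  (⟦injP0 U⟧ ⁄ ⟦cid K⟧) ∣ ⟦chi (U^+ ⊗ K) C⟧ ≡ ⟦chi K C⟧ ∣ (⟦injP0 U⟧ ⁄ ⟦cid K⟧).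
Proof.
rewrite chi_tens interchange //= iterPs_injP0 hor1d // -{1}(@hord1 _ K ⟦chi K C⟧) //.
by rewrite -interchange // ver1d.
Qed.

Lemma chi_injP1 (X : dmcat) (U K : vexp X) (C : X) :
  (⟦injP1 U⟧ ⁄ ⟦cid K⟧) ∣ ⟦chi (U^+ ⊗ K) C⟧ ≡
  (⟦chi U C⟧ ⁄ ⟦chi (U^+ ⊗ K) C⟧) ∣ (⟦injP1 U⟧ ⁄ ⟦cid K⟧).
Proof.
rewrite !chi_tens verA !interchange //=; rewrite iterPs_injP1.
by rewrite hord1 // hor1d.
Qed.

Lemma slides_iterX (X : dmcat) (V : vexp X) (A : X) (U W : vexp X) (B : X) (K : vexp X)
    (a : cell V A A U) (f : cell W A B K) (g : cell W unit unit (V ⊗ W)) :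
  slides a -> slides f -> slides g -> slides (iterX a f g).
Proof.
move=> sa sf sg C; rewrite -slide_botE -slide_topE; apply/cell_diag_eq.
(* The common value: the iterated state is [A ⊗ C], so [C] is carried along through every round and
   braided past the result only in the final [f]. *)
apply: (@ceq_trans _ _ _ _ _ _ _ _ _ _ (iterX (hcomp a (chi U C)) (slide_bot C f) g)).
  apply: iterX_unique; rewrite !slide_botE ver_hor_right_bot // -horA.
    by rewrite chi_projX0 horA hor_iterX0.
  rewrite chi_projX1 horA hor_iterX1 -horA interchange // cell_diag_hcomp.
  by rewrite -ver_hor_left_bot // verA.
apply: ceq_sym; apply: iterX_unique; rewrite slide_topE ver_hor_right // -horA.
  by rewrite hor_iterX0 slide_botE sf.
(* Moving [g] left past the crossing splits it into [chi V C] beside [a] and [chi W C] beside the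
   remaining iteration. Sliding [a] then leaves a braiding above the latter, restoring
   [slide_top]. *)
rewrite hor_iterX1 horA -slides_unit // chi_tens -horA interchange //.
by rewrite -ver_hor_left // cell_diag_hcomp !verA sa.
Qed.

Lemma slides_iterP (X : dmcat) (U : vexp X) (A : X) (V K : vexp X) (B : X) (W : vexp X)
    (a : cell U A A V) (f : cell K A B W) (g : cell (V ⊗ W) unit unit W) :
  slides a -> slides f -> slides g -> slides (iterP a f g).
Proof.
move=> sa sf sg C; rewrite -slide_botE -slide_topE; apply/cell_diag_eq.
apply: (@ceq_trans _ _ _ _ _ _ _ _ _ _ (iterP (hcomp a (chi V C)) (slide_bot C f) g)).
  apply: iterP_unique; rewrite !slide_botE ver_hor_left_bot // horA.
    by rewrite hor_iterP0.
  (* Dually, [g] stands on the right here, so it is this half in which it must commute with a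
     crossing. *)
  rewrite hor_iterP1 -horA slides_unit // chi_tens horA interchange // cell_diag_hcomp.
  by rewrite -ver_hor_right_bot // verA.
apply: ceq_sym; apply: iterP_unique; rewrite slide_topE ver_hor_left // horA.
  by rewrite chi_injP0 -horA hor_iterP0 slide_botE sf.
rewrite chi_injP1 -horA hor_iterP1 horA interchange //.
by rewrite -ver_hor_right // cell_diag_hcomp !verA sa.
Qed.

Theorem lemma21 (X : dmcat) (U W : vexp X) (A B C : X) (alpha : cell U A B W) :
  (ccast veq_tensv1 eq_refl eq_refl veq_tensv1
     (vcomp (hcomp alpha (chi W C)) (emb (braid B C)))
   : cell U (A ⊗ C)%obj (C ⊗ B)%obj W)
  ≈
  (ccast veq_tens1v eq_refl eq_refl veq_tens1v
     (vcomp (emb (braid A C)) (hcomp (chi U C) alpha))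
   : cell U (A ⊗ C)%obj (C ⊗ B)%obj W).
Proof.
(* The two sides are [slide_bot C alpha] and [slide_top C alpha] unfolded; as diagrams they lose
   their casts. *)
apply/cell_diag_eq; rewrite slide_botE slide_topE.
suff: slides alpha by exact.
elim: alpha => *.
- exact: slides_ccast.
- exact: slides_cid.
- exact: slides_cone.
- exact: slides_hcomp.
- exact: slides_vcomp.
- exact: slides_emb.
- exact: slides_getL.
- exact: slides_putR.
- exact: slides_getR.
- exact: slides_putL.
- exact: slides_cproj0.
- exact: slides_cproj1.
- exact: slides_cpair.
- exact: slides_cinj0.
- exact: slides_cinj1.
- exact: slides_ccase.
- exact: slides_ccopair.
- exact: slides_iterX.
- exact: slides_iterP.
Qed.
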